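(* Let $X$ be a Banach space, let $p\in(1,+\infty]$ and let $q\in[1,\infty)$ be the conjugate exponent of $p$ (that is, $\frac1p+\frac1q=1$, with $\frac1\infty=0$). If the dual space $X^*$ admits an equivalent dual norm which is $q$-AUC$^*$, then $X^*$ has property $\mathcal{Q}_p$.
   Context: Interlaced graphs: $\mathbb{N}=\{1,2,\dots\}$. For $k\in\mathbb{N}$ and an infinite $\mathbb{M}\subset\mathbb{N}$, $[\mathbb{M}]^k$ is the set of all $k$-element subsets of $\mathbb{M}$, written as strictly increasing $k$-tuples. Two distinct $\overline n=(n_1,\dots,n_k),\overline m=(m_1,\dots,m_k)\in[\mathbb{N}]^k$ are adjacent if and only if $n_1\le m_1\le n_2\le m_2\le\dots\le n_k\le m_k$ or $m_1\le n_1\le m_2\le n_2\le\dots\le m_k\le n_k$; $d_{\mathbb{K}}$ is the shortest path metric of this graph on $[\mathbb{N}]^k$. For a map $f:(M,d_M)\to(N,d_N)$ between metric spaces, $\omega_f(t)=\sup\{d_N(f(x),f(y)): d_M(x,y)\le t\}$. Property $\mathcal{Q}_p$ ($p\in(1,+\infty]$): a Banach space $Z$ has property $\mathcal{Q}_p$ if there is $C\ge1$ such that for every $k\in\mathbb{N}$ and every Lipschitz map $f:([\mathbb{N}]^k,d_{\mathbb{K}})\to Z$ there is an infinite $\mathbb{M}\subset\mathbb{N}$ with $\|f(\overline n)-f(\overline m)\|\le C\,\omega_f(1)\,k^{1/p}$ for all $\overline n,\overline m\in[\mathbb{M}]^k$ (with $1/\infty=0$). $q$-AUC$^*$: for a Banach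 space $X$, let $\mathrm{CoFin}^*(X^* )$ be the set of weak$^*$ closed finite-codimensional subspaces of $X^*$, and for $t\ge0$ let $$\overline{\delta}_X^*(t)=\inf_{x^*\in\partial B_{X^*}}\ \sup_{E\in\mathrm{CoFin}^*(X^* )}\ \inf_{y^*\in\partial B_E}\|x^*+ty^*\|-1,$$ where $\partial B$ denotes the unit sphere. For $q\in[1,\infty)$, (the dual norm of) $X^*$ is $q$-AUC$^*$ (weak$^*$ $q$-asymptotically uniformly convex) if there is $C>0$ with $\overline\delta_X^*(t)\ge Ct^q$ for all $t\in[0,1]$. An equivalent dual norm on $X^*$ is the dual norm of an equivalent norm on $X$. *)

(* Defs.v *)
From HB Require Import structures.
From mathcomp Require Import all_boot all_order all_algebra.
From mathcomp Require Import all_classical all_reals all_analysis.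

Set Implicit Arguments.
Unset Strict Implicit.
Unset Printing Implicit Defensive.

Import Order.TTheory GRing.Theory Num.Theory.
Import numFieldNormedType.Exports.

Local Open Scope classical_set_scope.
Local Open Scope ring_scope.

Section dual_space.
Context {R : realType} (X : normedModType R).

Definition dual_pred : {pred X -> R^o} :=
  [pred f : X -> R^o | `[< linear f /\ continuous f >]].

Record dual := Dual {
  dual_fun :> X -> R^o ;
  dual_funP : dual_fun \in dual_pred }.

HB.instance Definition _ := [isSub for dual_fun].
HB.instance Definition _ := [Choice of dual by <:].

Lemma dual_submod_closed : submod_closed dual_pred.
Proof.
split=> [|a f g]; rewrite !inE.
  split=> [b x y /=|]; last exact: cst_continuous.
  by rewrite scaler0 addr0.
move=> [lf cf] [lg cg]; split.
  move=> b x y; rewrite -![(a *: f + g) _]/(a *: f _ + g _) lf lg.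
  by rewrite !scalerDr !scalerA (mulrC a) addrACA.
by move=> x; apply: cvgD; [apply: cvgZr; exact: cf | exact: cg].
Qed.

HB.instance Definition _ :=
  GRing.isSubmodClosed.Build _ _ dual_pred dual_submod_closed.
HB.instance Definition _ := [SubChoice_isSubLmodule of dual by <:].

Lemma dual_linear (f : dual) : linear f.
Proof. by have := dual_funP f; rewrite inE => -[]. Qed.

HB.instance Definition _ (f : dual) :=
  GRing.isLinear.Build R X R^o _ f (dual_linear f).

Lemma dual_continuous (f : dual) : continuous f.
Proof. by have := dual_funP f; rewrite inE => -[]. Qed.

Lemma dual_bounded (f : dual) : exists2 M : R, 0 < M & forall x, `|f x| <= M * `|x|.
Proof.
have /linear_boundedP := continuous_linear_bounded 0 (@dual_continuous f 0).
move=> /pinfty_ex_gt0[M M0 fM]; by exists M.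
Qed.

Definition dual_norm (N : X -> R) (f : dual) : R :=
  sup [set `|f x| | x in [set x | N x <= 1]].

Let nrm := dual_norm (fun x : X => `|x|).

Implicit Types (f g : dual) (x : X).

Let has_sup_nrm f : has_sup [set `|f x| | x in [set x | `|x| <= 1]].
Proof.
split; first by exists `|f 0|, 0 => //=; rewrite normr0.
have [M M0 fM] := dual_bounded f; exists M => _ [x /= x1 <-].
by rewrite (le_trans (fM x))// ler_piMr// ltW.
Qed.

Let nrm_ub f x : `|x| <= 1 -> `|f x| <= nrm f.
Proof. by move=> x1; apply: ub_le_sup; [case: (has_sup_nrm f) | exists x]. Qed.

Let nrm_le f M : (forall x, `|x| <= 1 -> `|f x| <= M) -> nrm f <= M.
Proof.
move=> fM; apply: ge_sup; first by case: (has_sup_nrm f).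
by move=> _ [x /= x1 <-]; exact: fM.
Qed.

Lemma dual_norm_bound f x : `|f x| <= nrm f * `|x|.
Proof.
have [->|x0] := eqVneq x 0; first by rewrite linear0 !normr0 mulr0.
have x_gt0 : 0 < `|x| by rewrite normr_gt0.
rewrite -ler_pdivrMr//.
have -> : `|f x| / `|x| = `|f (`|x|^-1 *: x)|.
  by rewrite linearZ normrM normfV normr_id mulrC.
by apply: nrm_ub; rewrite normrZ normfV normr_id mulVf// gt_eqF.
Qed.

Let nrmD f g : nrm (f + g) <= nrm f + nrm g.
Proof.
apply: nrm_le => x x1; rewrite (le_trans (ler_normD _ _))//.
by rewrite lerD// nrm_ub.
Qed.

Let nrmZ_le a f : nrm (a *: f) <= `|a| * nrm f.
Proof. by apply: nrm_le => x x1; rewrite normrM ler_wpM2l// nrm_ub. Qed.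

Let nrmZ a f : nrm (a *: f) = `|a| * nrm f.
Proof.
apply/eqP; rewrite eq_le nrmZ_le/=.
have [->|a0] := eqVneq a 0.
  rewrite normr0 mul0r (le_trans (normr_ge0 ((0 *: f : dual) 0)))//.
  by apply: nrm_ub; rewrite normr0.
rewrite -ler_pdivlMl ?normr_gt0// -normfV.
by rewrite -{1}[f](scalerK a0) nrmZ_le.
Qed.

Let nrm0 f : nrm f = 0 -> f = 0.
Proof.
move=> f0; apply/val_inj/funext => x /=; apply/normr0_eq0/eqP.
by rewrite -normr_le0 normr_id (le_trans (dual_norm_bound f x))// f0 mul0r.
Qed.

HB.instance Definition _ := Lmodule_isNormed.Build R dual nrmD nrmZ nrm0.

Lemma dual_normE (f : dual) : `|f| = dual_norm (fun x : X => `|x|) f.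
Proof. by []. Qed.

Let dual_complete (F : set_system dual) :
  ProperFilter F -> cauchy F -> cvg F.
Proof.
move=> FF /cauchy_ballP cF.
pose close (e : R) (f h : X -> R^o) := forall x, `|f x - h x| <= e * `|x|.
have {}cF e : 0 < e -> \forall f & h \near F, close e (dual_fun f) (dual_fun h).
  move=> e0; apply: filterS (cF _ e0) => -[f h]/=.
  rewrite -ball_normE/= => fhe x.
  rewrite (le_trans (dual_norm_bound (f - h) x))// ler_wpM2r// ltW//.
have Fx x : cvg ((fun f : dual => f x : R^o) @ F).
  apply: R_complete; apply/cauchy_ballP => e e0; rewrite near_map2.
  have e1 : 0 < e / (`|x| + 1) by rewrite divr_gt0// ltr_wpDl.
  apply: filterS (cF _ e1) => -[f h]/= /(_ x) fh.
  rewrite /ball/= (le_lt_trans fh)//.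
  rewrite -mulrA gtr_pMr// mulrC ltr_pdivrMr ?ltr_wpDl// mul1r ltrDl//.
pose g x : R^o := lim ((fun f : dual => f x : R^o) @ F).
have gE x : (fun f : dual => f x : R^o) @ F --> g x by exact: Fx.
have glin : linear g.
  move=> a x y; apply: (cvg_unique _ (gE _)) => //.
  rewrite (_ : (fun f : dual => _) = fun f : dual => a *: (f x : R^o) + f y).
    2: by apply/funext => f; rewrite dual_linear.
  exact: (cvgD (cvgZr (gE x)) (gE y)).
have gP e : 0 < e -> \forall f \near F, close e (dual_fun f) g.
  move=> /cF/nearP_dep; apply: filterS => f fh x.
  have : (fun h : dual => `|f x - h x|) @ F --> `|f x - g x|.
    by apply: cvg_norm; apply: cvgB; [exact: cvg_cst|exact: gE].
  by move=> cv; apply: (cvgr_to_le cv); apply: filterS fh => h; exact.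
pose gl : {linear X -> R^o} := HB.pack g (GRing.isLinear.Build R X R^o _ g glin).
have [h hg] := filter_ex (gP 1 ltr01).
have gcont : continuous g.
  apply: (@bounded_linear_continuous R X R^o gl); apply/bounded_funP => r.
  exists ((`|h| + 1) * `|r|) => x xr /=.
  have -> : g x = h x - (h x - g x) by rewrite subKr.
  rewrite (le_trans (ler_normB _ _))// (@le_trans _ _ ((`|h| + 1) * `|x|))//.
    by rewrite mulrDl lerD ?dual_norm_bound.
  by rewrite ler_wpM2l ?addr_ge0// (le_trans xr)// ler_norm.
have gdual : (g : X -> R^o) \in dual_pred by rewrite inE; split.
apply/cvg_ex; exists (Dual gdual); apply/cvgrPdist_le => /= e e0.
apply: filterS (gP e e0) => f fg; apply: nrm_le => x x1.
by rewrite -normrN opprB (le_trans (fg x))// ler_piMr// ltW.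
Qed.

HB.instance Definition _ := Uniform_isComplete.Build dual dual_complete.

End dual_space.

Section asymptotic_convexity.
Context {R : realType} (X : normedModType R).

Definition equivalent_norm (N : X -> R) : Prop :=
  [/\ forall x y, N (x + y) <= N x + N y,
      forall a x, N (a *: x) = `|a| * N x &
      exists c C : R, [/\ 0 < c, 0 < C &
        forall x, c * `|x| <= N x <= C * `|x|] ].

Definition weak_star : topologicalType :=
  initial_topology (fun f : dual X => (f : {ptws X -> R})).

Definition linear_subspace (E : set (dual X)) : Prop :=
  E 0 /\ forall (a : R) f g, E f -> E g -> E (a *: f + g).

Definition finite_codim (E : set (dual X)) : Prop :=
  exists s : seq (dual X), forall f : dual X,
    exists (e : dual X) (a : 'I_(size s) -> R),
      E e /\ f = e + \sum_(i < size s) a i *: s`_i.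

Definition cofin_star : set (set (dual X)) :=
  [set E : set (dual X) |
    [/\ linear_subspace E, @closed weak_star E & finite_codim E] ].

Definition unit_sphere (N : X -> R) (E : set (dual X)) : set (dual X) :=
  [set f | E f /\ dual_norm N f = 1].

Local Open Scope ereal_scope.

(* The infimum over an empty sphere is +oo, as usual; this occurs exactly when
   E = {0}, hence for suitable E as soon as X is finite-dimensional. *)
Definition delta_star (N : X -> R) (t : R) : \bar R :=
  ereal_inf
    [set ereal_sup
       [set ereal_inf [set (dual_norm N (f + t *: g)%R)%:E |
                        g in unit_sphere N E]
       | E in cofin_star]
    | f in unit_sphere N setT] - 1.

Definition AUC_star (q : R) (N : X -> R) : Prop :=
  exists2 C : R, (0 < C)%R &
    forall t : R, (0 <= t <= 1)%R -> (C * t `^ q)%R%:E <= delta_star N t.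

End asymptotic_convexity.

Section interlaced_graph.
Variable k : nat.

(* [N]^k with N = {1, 2, ...}: the condition reads 0 < n_1 < ... < n_k. *)
Definition ksubset : Type := {n : k.-tuple nat | path ltn 0%N n}.

Definition entry (n : ksubset) (i : nat) : nat := nth 0%N (val n) i.

Definition ksubsets_of (M : set nat) : set ksubset :=
  [set n | forall i, (i < k)%N -> M (entry n i)].

(* n_1 <= m_1 <= n_2 <= m_2 <= ... <= n_k <= m_k *)
Definition interlaced (n m : ksubset) : bool :=
  [forall i : 'I_k, (entry n i <= entry m i)%N] &&
  [forall i : 'I_k, (i.+1 < k)%N ==> (entry m i <= entry n i.+1)%N].

Definition interlaced_adj : rel ksubset :=
  [rel n m | (n != m) && (interlaced n m || interlaced m n)].

Definition walk_length (n m : ksubset) : pred nat :=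
  [pred l | `[< exists s : seq ksubset,
     [/\ path interlaced_adj n s, last n s = m & size s = l] >] ].

Let reach n m := exists l, walk_length n m l.

Let reach_refl n : reach n n.
Proof. by exists 0%N; apply/asboolP; exists [::]. Qed.

Let reach_trans m n p : reach n m -> reach m p -> reach n p.
Proof.
move=> [_ /asboolP[s [ns sm _]]] [_ /asboolP[t [mt tp _]]].
exists (size (s ++ t)); apply/asboolP; exists (s ++ t).
by rewrite cat_path last_cat sm ns.
Qed.

Let interlaced_adj_sym : symmetric interlaced_adj.
Proof. by move=> n m; rewrite /interlaced_adj/= eq_sym orbC. Qed.

Let reach_sym n m : reach n m -> reach m n.
Proof.
move=> [_ /asboolP[s [ns sm _]]].
exists (size (rev (belast n s))); apply/asboolP.
exists (rev (belast n s)); split => //.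
- rewrite -sm rev_path; apply: sub_path ns => u v /=.
  by rewrite -/(interlaced_adj v u) interlaced_adj_sym.
- by case: s sm {ns} => //= a s _; rewrite rev_cons last_rcons.
Qed.

Let reach_step n m : interlaced n m -> reach n m.
Proof.
move=> nm; have [->|neq] := eqVneq n m; first exact: reach_refl.
exists 1%N; apply/asboolP; exists [:: m].
by split=> //; apply/andP; split=> //; apply/andP; split; [exact: neq|rewrite nm].
Qed.

(* The k-windows of an increasing sequence starting with n join n to a set of
   consecutive integers that depends only on the upper bound T. *)
Let far T i := (T + i.+1)%N.

Let window_path (u : nat -> nat) : (forall i, 0 < u i)%N ->
  (forall i j, (i < j)%N -> (u i < u j)%N) ->
  path ltn 0%N [tuple u i | i < k].
Proof.
move=> u0 ult; rewrite /= map_comp val_enum_ord path_sortedE; last exact: ltn_trans.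
rewrite all_map; apply/andP; split; first by apply/allP => i _; exact: u0.
by rewrite sorted_map; apply: sub_sorted (iota_ltn_sorted 0 k) => i j; exact: ult.
Qed.

Let reach_far n T : (forall i, (entry n i <= T)%N) ->
  exists2 m, reach n m & forall i, (i < k)%N -> entry m i = far T i.
Proof.
move=> nT; pose u i := if (i < k)%N then entry n i else far T (i - k).
have n_sorted : sorted ltn (val n) by exact: path_sorted (valP n).
have u0 i : (0 < u i)%N.
  rewrite /u; case: (ltnP i k) => [ik|_]; last by rewrite /far addnS.
  have := valP n; rewrite path_sortedE; last exact: ltn_trans.
  by move=> /andP[/allP h _]; apply: (h (entry n i)); rewrite mem_nth// size_tuple.
have ult i j : (i < j)%N -> (u i < u j)%N.
  move=> ij; rewrite /u; case: (ltnP j k) => [jk|kj].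
    rewrite (ltn_trans ij jk); apply: (sorted_ltn_nth ltn_trans) => //;
      by rewrite inE size_tuple// (ltn_trans ij jk).
  case: (ltnP i k) => [ik|ki]; first by rewrite /far addnS ltnS (leq_trans (nT i))// leq_addr.
  by rewrite /far ltn_add2l ltnS ltn_sub2r// (leq_ltn_trans ki).
have path_w j : path ltn 0%N [tuple u (i + j)%N | i < k].
  apply: (window_path (u := fun i => u (i + j)%N)) => [//|a b ab]; apply: ult; by rewrite ltn_add2r.
pose w j : ksubset := Sub [tuple u (i + j)%N | i < k] (path_w j).
have wE j i : (i < k)%N -> entry (w j) i = u (i + j)%N.
  move=> ik; rewrite /entry -[i]/(val (Ordinal ik)) -tnth_nth tnth_mktuple//.
have reach_w j : reach (w 0) (w j).
  elim: j => [|j IH]; first exact: reach_refl.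
  apply: (reach_trans IH); apply: reach_step; apply/andP; split.
    apply/forallP => i; rewrite !wE// addnS; apply: ltnW; exact: ult.
  by apply/forallP => i; apply/implyP => ik; rewrite !wE// addnS addSn.
exists (w k).
  suff <- : w 0%N = n by exact: reach_w.
  apply/val_inj/val_inj/(@eq_from_nth _ 0%N); rewrite ?size_tuple// => i ik.
  by rewrite -/(entry _ _) -/(entry n _) wE// addn0 /u ik.
by move=> i ik; rewrite wE// /u ltnNge leq_addl/= addnK.
Qed.

Lemma walk_exists n m : exists l, walk_length n m l.
Proof.
pose T := maxn (\max_(i < k) entry n i) (\max_(i < k) entry m i).
have bound p i : (\max_(j < k) entry p j <= T)%N -> (entry p i <= T)%N.
  move=> pT; have [ik|ki] := ltnP i k.
    by rewrite (leq_trans _ pT)// (leq_bigmax (Ordinal ik)).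
  by rewrite /entry nth_default// size_tuple.
have [n' nn' n'E] := @reach_far n T (fun i => bound n i (leq_maxl _ _)).
have [m' mm' m'E] := @reach_far m T (fun i => bound m i (leq_maxr _ _)).
suff n'm' : n' = m' by apply: (reach_trans nn'); rewrite n'm'; exact: reach_sym.
apply/val_inj/val_inj/(@eq_from_nth _ 0%N); rewrite ?size_tuple// => i ik.
by rewrite -/(entry _ _) -/(entry m' _) n'E// m'E.
Qed.

Definition interlaced_dist (n m : ksubset) : nat := ex_minn (walk_exists n m).

End interlaced_graph.

Section property_Q.
Context {R : realType}.

Definition is_lipschitz (T : Type) (d : T -> T -> R) (Z : normedModType R)
    (f : T -> Z) : Prop :=
  exists L : R, forall x y, `|f x - f y| <= L * d x y.

Definition modulus (T : Type) (d : T -> T -> R) (Z : normedModType R)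
    (f : T -> Z) (t : R) : \bar R :=
  ereal_sup [set `|f xy.1 - f xy.2|%:E | xy in [set xy | d xy.1 xy.2 <= t]].

Definition dK (k : nat) (n m : ksubset k) : R := (interlaced_dist n m)%:R.

Definition property_Q (p : \bar R) (Z : completeNormedModType R) : Prop :=
  exists2 C : R, 1 <= C &
    forall (k : nat) (f : ksubset k -> Z), (0 < k)%N ->
      is_lipschitz (@dK k) f ->
      exists M : set nat, [/\ M `<=` [set i | (0 < i)%N], infinite_set M &
        forall n m, ksubsets_of M n -> ksubsets_of M m ->
          (`|f n - f m|%:E <=
             C%:E * modulus (@dK k) f 1 * (k%:R `^ fine p^-1)%:E)%E ].

End property_Q.

(* Main.v *)
Require Import Defs.
From HB Require Import structures.
From mathcomp Require Import all_boot all_order all_algebra.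
From mathcomp Require Import all_classical all_reals all_analysis.
From mathcomp Require Import ring lra zify.

(**
Write |.| for the q-asymptotically uniformly convex dual norm; it is equivalent
to the original one, so it suffices to prove the estimate for it.

Fix a nonprincipal ultrafilter U on the integers and a Lipschitz map f on the
interlaced graph, with modulus w at distance 1. Balls of the dual are weak-star
compact, so taking weak-star limits along U in the last coordinate, then in the
previous one, and so on, extends f to a tree g indexed by all tuples of length
at most k: g agrees with f on k-tuples, and g (s, a) tends weak-star to g s
when a tends to U ([weak_star_tree]). Along a branch n, the map f decomposes as
g () plus the increments d_i = g (n_1..n_i) - g (n_1..n_(i-1)), and each d_i
is weak-star null in its last coordinate.

Asymptotic uniform convexity with power q says that a weak-star null
perturbation z of a fixed vector x satisfies, in the limit along U,
|x + z|^q >= |x|^q + c |z|^q ([AUC_star_lower_estimate]). Choose two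
interlacing branches alternately, n_1 < m_1 < n_2 < m_2 < ..., each coordinate
far enough along U. Applying the estimate at every choice to the partial
difference g (n_1..n_i) - g (m_1..m_j) gives, up to a small error,
  |f n - f m|^q >= c (|d_1|^q + ... + |d_k|^q).
But n and m are adjacent in the graph, so the left-hand side is at most w^q.
Hence the increments along n are bounded in l_q by a multiple of w, and
therefore in l_1 by a multiple of w k^(1 - 1/q) = w k^(1/p), which bounds
|f n - g ()|. Two values of f on such branches are thus at distance at most a
multiple of w k^(1/p).

The branches n for which a partner m exists form a tree whose nodes have
U-many successors, and such a tree contains all increasing tuples of some
infinite set M ([tree_extraction]). This M is the required set.
*)

Set Implicit Arguments.
Unset Strict Implicit.
Unset Printing Implicit Defensive.

Import Order.TTheory GRing.Theory Num.Theory.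
Import numFieldNormedType.Exports.

Local Open Scope classical_set_scope.
Local Open Scope ring_scope.

(** * Limits along ultrafilters, and powers *)

Lemma ultra_bounded_cvg (R : realType) (T : Type) (U : set_system T)
    (UF : UltraFilter U) (u : T -> R) (B : R) :
  (\forall n \near U, `|u n| <= B) -> exists l : R, u @ U --> l.
Proof.
move=> uB.
have UP : ProperFilter (u @ U) by exact: fmap_proper_filter.
have [|l [_ ul]] := @segment_compact R (- B) B (u @ U) _.
  by apply: filterS uB => n; rewrite /= in_itv/= -ler_norml.
exists l => A Al.
have [//|UA] := in_ultra_setVsetC (u @^-1` A) UF.
by have [r [/=]] := ul (~` A) A UA Al.
Qed.

(** [powR] is not continuous at 0 from the left, as it takes the value 1 on
negative numbers: this is why [u] is assumed to be nonnegative. *)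
Lemma powR_cvg (R : realType) (T : Type) (F : set_system T) (FF : Filter F)
    (u : T -> R) (l q : R) :
  1 <= q -> (forall n, 0 <= u n) -> 0 <= l -> u @ F --> l ->
  (fun n => u n `^ q) @ F --> l `^ q.
Proof.
move=> q1 u0; rewrite le_eqVlt => /predU1P[<-|l0] ul; last first.
  have : {for l, continuous (fun x : R => x `^ q)}.
    2: by move=> cq; exact: (continuous_cvg _ cq ul).
  apply: differentiable_continuous; apply/derivable1_diffP.
  by apply: derivable_powR; rewrite in_itv/= l0.
rewrite powR0; last by rewrite gt_eqF// (lt_le_trans _ q1).
apply: (@squeeze_cvgr _ _ _ _ (cst 0) u) => //; last exact: cvg_cst.
have : \forall n \near F, `|0 - u n| <= 1.
  by exact: (proj1 (cvgrPdist_le _ _) ul 1 ltr01).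
apply: filterS => n; rewrite sub0r normrN ger0_norm// => u1.
rewrite powR_ge0/=; have [->|un0] := eqVneq (u n) 0.
  by rewrite powR0// gt_eqF// (lt_le_trans _ q1).
by apply: ge1r_powR => //; rewrite u1 andbT lt_def un0 u0.
Qed.

Lemma powR_superadd (R : realType) (q a b : R) :
  1 <= q -> 0 <= a -> 0 <= b -> a `^ q + b `^ q <= (a + b) `^ q.
Proof.
move=> q1 a0 b0.
have q0 : 0 < q by rewrite (lt_le_trans _ q1).
rewrite -(mulr_powRB1 a0 q0) -(mulr_powRB1 b0 q0).
rewrite -(mulr_powRB1 (addr_ge0 a0 b0) q0) mulrDl.
have q'0 : 0 <= q - 1 by rewrite subr_ge0.
by rewrite lerD// ler_wpM2l// ge0_ler_powR// ?nnegrE ?addr_ge0// ?lerDl ?lerDr.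
Qed.

(** Hoelder's inequality up to a constant, by truncation at the level
[y = w * k%:R `^ (- q^-1)]: either [a i <= y], or
[a i <= a i `^ q / y `^ (q - 1)]. *)
Lemma sum_le_powR (R : realType) (k : nat) (q w D : R) (a : 'I_k -> R) :
  (0 < k)%N -> 1 <= q -> 0 < w -> 0 <= D -> (forall i, 0 <= a i) ->
  \sum_i a i `^ q <= D * w `^ q ->
  \sum_i a i <= (1 + D) * w * k%:R `^ (1 - q^-1).
Proof.
move=> k0 q1 w0 D0 a0 aD.
have q0 : 0 < q by rewrite (lt_le_trans _ q1).
have kR0 : 0 < k%:R :> R by rewrite ltr0n.
have kn0 : k%:R != 0 :> R by rewrite gt_eqF.
have wn0 : w != 0 by rewrite gt_eqF.
set y := w * k%:R `^ (- q^-1).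
have y0 : 0 < y by rewrite mulr_gt0// powR_gt0.
have yq0 : 0 < y `^ (q - 1) by rewrite powR_gt0.
have ay i : a i <= y + a i `^ q / y `^ (q - 1).
  have [ai_le|y_lt] := leP (a i) y.
    by rewrite (le_trans ai_le)// lerDl mulr_ge0 ?powR_ge0// invr_ge0 ltW.
  rewrite ler_wpDl//; first exact: ltW.
  rewrite ler_pdivlMr// -[leRHS](mulr_powRB1 (a0 i) q0) ler_wpM2l//.
  apply: ge0_ler_powR; rewrite ?nnegrE// ?subr_ge0//; exact: ltW.
apply: (le_trans (ler_sum _ (fun i _ => ay i))).
rewrite big_split/= sumr_const card_ord -mulr_suml.
have yqE : y `^ (q - 1) = w `^ q / w * k%:R `^ (q^-1 - 1).
  rewrite /y powRM ?powR_ge0//; last exact: ltW.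
  rewrite -powRrM mulNr mulrBr mulr1 mulVf ?gt_eqF// opprB.
  rewrite (@powRB _ w q 1); last by rewrite wn0 implybT.
  by rewrite powRr1// ltW.
have kE : k%:R `^ (- q^-1) *+ k = k%:R `^ (1 - q^-1) :> R.
  rewrite -mulr_natr mulrC powRD; last by rewrite kn0 implybT.
  by rewrite powRr1// ltW.
rewrite -mulrnAr kE -mulrA mulrDl mul1r mulrA lerD2l.
rewrite ler_pdivrMr// (le_trans aD)// yqE.
rewrite -[leRHS]mulrA; set u := k%:R `^ _; set v := k%:R `^ _.
have uv : u * v = 1.
  rewrite /u /v -powRD; last by rewrite kn0 implybT.
  by rewrite addrA subrK subrr powRr0.
have -> : D * w * (u * (w `^ q / w * v)) = D * w `^ q * (w / w) * (u * v) by ring.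
by rewrite uv divff ?gt_eqF// !mulr1.
Qed.

(** * The dual norm of an equivalent norm *)

Section equivalent_dual_norm.
Context {R : realType} (X : normedModType R) (N : X -> R).
Hypothesis hN : equivalent_norm N.
Implicit Types (f g : dual X) (x : X).
Local Notation dN := (dual_norm N).

Let N0 : N 0 = 0.
Proof. by have [_ NZ _] := hN; rewrite -(scale0r 0) NZ normr0 mul0r. Qed.

Let bounded_on_ball f : exists B, forall x, N x <= 1 -> `|f x| <= B.
Proof.
have [_ _ [c [C [c0 C0 NcC]]]] := hN.
have [B B0 fB] := dual_bounded f; exists (B * c^-1) => x x1.
apply: (le_trans (fB x)); apply: ler_wpM2l; first exact: ltW.
rewrite -[leRHS]mulr1 ler_pdivlMl// (le_trans _ x1)//.
by have /andP[] := NcC x.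
Qed.

Let has_sup_dN f : has_sup [set `|f x| | x in [set x | N x <= 1]].
Proof.
split; first by exists `|f 0|, 0 => //=; rewrite N0.
by have [B fB] := bounded_on_ball f; exists B => _ [x /= x1 <-]; exact: fB.
Qed.

Let dN_ub f x : N x <= 1 -> `|f x| <= dN f.
Proof. by move=> x1; apply: ub_le_sup; [case: (has_sup_dN f) | exists x]. Qed.

Lemma dual_norm_le f M : (forall x, N x <= 1 -> `|f x| <= M) -> dN f <= M.
Proof.
move=> fM; apply: ge_sup; first by case: (has_sup_dN f).
by move=> _ [x /= x1 <-]; exact: fM.
Qed.

Lemma dual_norm_ge0 f : 0 <= dN f.
Proof. by apply: (le_trans (normr_ge0 (f 0))); apply: dN_ub; rewrite N0. Qed.

Lemma dual_normD f g : dN (f + g) <= dN f + dN g.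
Proof.
apply: dual_norm_le => x x1; rewrite (le_trans (ler_normD _ _))//.
by rewrite lerD// dN_ub.
Qed.

Let dNZ_le a f : dN (a *: f) <= `|a| * dN f.
Proof. by apply: dual_norm_le => x x1; rewrite normrM ler_wpM2l// dN_ub. Qed.

Lemma dual_normZ a f : dN (a *: f) = `|a| * dN f.
Proof.
apply/eqP; rewrite eq_le dNZ_le/=.
have [->|a0] := eqVneq a 0; first by rewrite normr0 mul0r dual_norm_ge0.
rewrite -ler_pdivlMl ?normr_gt0// -normfV.
by rewrite -{1}[f](scalerK a0) dNZ_le.
Qed.

Lemma dual_norm0 : dN 0 = 0.
Proof. by rewrite -(scale0r 0) dual_normZ normr0 mul0r. Qed.

Lemma dual_normN f : dN (- f) = dN f.
Proof. by rewrite -scaleN1r dual_normZ normrN1 mul1r. Qed.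

Lemma dual_normB_dist f g : `|dN f - dN g| <= dN (f - g).
Proof.
rewrite ler_norml; apply/andP; split.
  rewrite lerNl opprB lerBlDr -[dN (f - g)]dual_normN opprB.
  by rewrite (le_trans _ (dual_normD _ _))// subrK.
by rewrite lerBlDr (le_trans _ (dual_normD _ _))// subrK.
Qed.

Lemma dual_norm_equivalent : exists b B : R, [/\ 0 < b, 0 < B &
  forall f, dN f <= B * `|f| /\ `|f| <= b * dN f].
Proof.
have [_ NZ [c [C [c0 C0 NcC]]]] := hN.
exists C, c^-1; split => // [|f]; first by rewrite invr_gt0.
split.
  apply: dual_norm_le => x x1; rewrite (le_trans (dual_norm_bound f x))//.
  rewrite -dual_normE mulrC; apply: ler_wpM2r => //.
  rewrite -[leRHS]mulr1 ler_pdivlMl// (le_trans _ x1)//.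
  by have /andP[] := NcC x.
rewrite dual_normE; apply: ge_sup.
  by exists `|f 0|, 0 => //=; rewrite normr0.
move=> _ [x /= x1 <-].
have : `|f (C^-1 *: x)| <= dN f.
  apply: dN_ub; rewrite NZ gtr0_norm ?invr_gt0// ler_pdivrMl// mulr1.
  have /andP[_ /le_trans] := NcC x; apply; by rewrite ler_piMr// ltW.
by rewrite linearZ normrM gtr0_norm ?invr_gt0// ler_pdivrMl.
Qed.

End equivalent_dual_norm.

(** * Weak-star closed subspaces of finite codimension *)

Section weak_star.
Context {R : realType} (X : normedModType R).
Implicit Types (E : set (dual X)) (f g v : dual X) (x : X).

Lemma dualDE f g x : (f + g) x = f x + g x. Proof. by []. Qed.

Lemma dualNE f x : (- f) x = - f x. Proof. by []. Qed.

Lemma dualZE (a : R) f x : (a *: f) x = a * f x. Proof. by []. Qed.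

Lemma dual_sumE (I : Type) (r : seq I) (F : I -> dual X) x :
  (\sum_(i <- r) F i) x = \sum_(i <- r) F i x.
Proof. by elim/big_rec2: _ => [//|i y g _ <-]. Qed.

Lemma weak_star_closed_lim (T : Type) (F : set_system T) {FF : ProperFilter F}
    E (e : T -> dual X) v :
  @closed (weak_star X) E -> (\forall n \near F, E (e n)) ->
  (forall x, e n x @[n --> F] --> (v x : R)) -> E v.
Proof.
move=> Ecl Ee ev.
apply: (@closed_cvg T (weak_star X) F FF e E Ecl Ee v) => A.
rewrite nbhsE => -[B [[C oC <-] Cv] BA].
apply: filterS BA _.
have /pointwise_cvgP : forall x, (fun h : X -> R => h x)
    @ ((fun n => (e n : X -> R)) @ F) --> (v : X -> R) x by exact: ev.
by apply; exact: open_nbhs_nbhs.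
Qed.

(** A spanning family of minimal length modulo [E] is free modulo [E]: a
nontrivial relation would express one of its members by the others. *)
Lemma finite_codim_complement E : linear_subspace E -> finite_codim E ->
  exists m (s : 'I_m -> dual X),
    (forall f, exists e (a : 'I_m -> R), E e /\ f = e + \sum_i a i *: s i) /\
    (forall a : 'I_m -> R, E (\sum_i a i *: s i) -> forall i, a i = 0).
Proof.
move=> [E0 Elin] [s0 s0E].
pose spans m (s : 'I_m -> dual X) := forall f, exists e (a : 'I_m -> R),
  E e /\ f = e + \sum_i a i *: s i.
have ex_m : exists m, `[< exists s, spans m s >].
  exists (size s0); apply/asboolP; exists (fun i => s0`_i) => f.
  by have [e [a [Ee ->]]] := s0E f; exists e, a.
case: (ex_minnP ex_m) => m /asboolP[s sE] m_min.
exists m, s; split=> // a Ea j; apply: contrapT => /eqP aj0.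
case: m s sE m_min a Ea j aj0 => [s _ _ a _ []//|m s sE m_min a Ea j aj0].
suff /asboolP/m_min : exists s, spans m s by rewrite ltnn.
exists (fun i => s (lift j i)) => f.
have [e [b [Ee fE]]] := sE f.
exists ((b j / a j) *: (\sum_i a i *: s i) + e).
exists (fun i => b (lift j i) - b j / a j * a (lift j i)).
split; first exact: Elin.
rewrite fE (bigD1_ord j)//= [in RHS](bigD1_ord j)//= scalerDr scalerA divfK//.
rewrite scaler_sumr -!addrA (addrCA e); congr (_ + _).
rewrite addrCA; congr (_ + _); rewrite -big_split/=; apply: eq_bigr => i _.
by rewrite scalerA -scalerDl addrC subrK.
Qed.

(** Weak-star null families are asymptotically contained in [E]. Decompose
[z n = e n + \sum_i a n i *: s i] along a complement of [E]. The coefficients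
need not be bounded a priori, so they are divided by [1 + S n], where [S n] is
the sum of their absolute values. After this normalization they converge along
the ultrafilter, and the limit combination of the [s i] is minus the weak-star
limit of elements of [E]; hence it lies in [E] and its coefficients vanish.
Then [S n / (1 + S n)] tends to 0, and so does [S n]. *)
Lemma cofin_star_approx (T : Type) (U : set_system T) {UF : UltraFilter U}
    E (z : T -> dual X) :
  cofin_star E -> (forall x, z n x @[n --> U] --> (0 : R)) ->
  exists2 e : T -> dual X, forall n, E (e n) & `|z n - e n| @[n --> U] --> (0 : R).
Proof.
move=> [Esub Ecl Efin] z0; have [E0 Elin] := Esub.
have EZ a f : E f -> E (a *: f) by move=> Ef; rewrite -[_ *: _]addr0; exact: Elin.
have [m [s [sE sfree]]] := finite_codim_complement Esub Efin.
have /choice[e /choice[a ea]] : forall n, exists e, exists a : 'I_m -> R,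
  E e /\ z n = e + \sum_i a i *: s i by move=> n; exact: sE.
exists e => [n|]; first by case: (ea n).
pose S n := \sum_i `|a n i|.
have S0 n : 0 <= S n by exact: sumr_ge0.
have S1 n : 0 < 1 + S n by rewrite ltr_pwDl.
pose b n i := a n i / (1 + S n).
have b1 i n : `|b n i| <= 1.
  rewrite normrM normfV (gtr0_norm (S1 n)) ler_pdivrMr// mul1r.
  by rewrite /S (bigD1 i)//= addrCA lerDl addr_ge0// sumr_ge0.
have /choice[l bl] : forall i, exists l : R, b n i @[n --> U] --> l.
  by move=> i; apply: (@ultra_bounded_cvg _ _ _ _ _ 1); apply: nearW => n.
have lE : E (\sum_i l i *: s i).
  suff /(EZ (-1)) : E (- \sum_i l i *: s i) by rewrite scaleN1r opprK.
  apply: (@weak_star_closed_lim _ U _ E (fun n => (1 + S n)^-1 *: e n)) => //.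
    by apply: nearW => n; apply: EZ; case: (ea n).
  move=> x.
  have eE n : ((1 + S n)^-1 *: e n) x =
      (1 + S n)^-1 * z n x - \sum_i b n i * s i x.
    have [_ ->] := ea n; rewrite dualZE dualDE dual_sumE mulrDr -addrA.
    rewrite [_ - _](_ : _ = 0) ?addr0 ?dualZE// mulr_sumr -sumrB big1// => i _.
    by rewrite dualZE /b mulrA (mulrC _^-1) subrr.
  rewrite (_ : (fun n => _) = fun n => (1 + S n)^-1 * z n x - \sum_i b n i * s i x);
    last by apply/funext => n; rewrite eE.
  rewrite dualNE dual_sumE -[X in _ --> X]add0r; apply: cvgB; last first.
    apply: cvg_big => [|i _]; first exact: add_continuous.
    by rewrite dualZE; apply: cvgMl; exact: bl.
  apply/cvgr0Pnorm_le => r r0.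
  apply: filterS (proj1 (cvgr0Pnorm_le _) (z0 x) r r0) => n zr.
  rewrite normrM normfV (gtr0_norm (S1 n)) mulrC ler_pdivrMr//.
  by rewrite (le_trans zr)// ler_pMr// lerDl.
have l0 := sfree _ lE.
apply: (proj2 (cvgr0Pnorm_le _)) => r r0.
pose K := \sum_i `|s i|.
have K1 : 0 < 1 + K by rewrite ltr_pwDl// sumr_ge0.
have : \sum_i `|b n i| @[n --> U] --> (0 : R).
  rewrite [X in _ --> X](_ : 0 = \sum_(i < m) `|l i|); last first.
    by rewrite big1// => i _; rewrite l0 normr0.
  apply: cvg_big => [|i _]; first exact: add_continuous.
  by apply: cvg_norm; exact: bl.
(* The value d / (1 + d) is the image of d under x |-> x / (1 + x). *)
pose d := r / (1 + K).
have d0 : 0 < d by rewrite divr_gt0.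
have d1 : 0 < d / (1 + d) by rewrite divr_gt0// addr_gt0.
move=> /cvgr0Pnorm_le/(_ _ d1); apply: filterS => n.
have -> : \sum_i `|b n i| = S n / (1 + S n).
  rewrite /S mulr_suml; apply: eq_bigr => i _.
  by rewrite normrM normfV (gtr0_norm (S1 n)).
rewrite ger0_norm; last by rewrite divr_ge0// ltW.
move=> Sd.
have {}Sd : S n <= d.
  move: Sd; rewrite ler_pdivrMr// mulrAC ler_pdivlMr ?addr_gt0//.
  by move=> ?; lra.
have [_ ->] := ea n; rewrite addrC addKr normr_id.
apply: (le_trans (ler_norm_sum _ _ _)).
apply: (@le_trans _ _ (S n * K)).
  rewrite /S mulr_suml; apply: ler_sum => i _; rewrite normrZ ler_wpM2l//.
  by rewrite /K (bigD1 i)//= lerDl sumr_ge0.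
rewrite (@le_trans _ _ (d * (1 + K)))//; last by rewrite /d divfK// gt_eqF.
rewrite ler_pM// ?sumr_ge0// lerDr//.
Qed.

End weak_star.

(** * Asymptotic uniform convexity as a lower estimate *)

Section asymptotic_convexity.
Context {R : realType} (X : normedModType R) (N : X -> R).
Hypothesis hN : equivalent_norm N.
Context (U : set_system nat) {UF : UltraFilter U}.
Implicit Types (f g : dual X) (x : X).
Local Notation dN := (dual_norm N).

Lemma delta_star_witness (t d eps : R) f : 0 < eps -> (d%:E <= delta_star N t)%E ->
  dN f = 1 -> exists2 E : set (dual X), cofin_star E &
    forall g, E g -> dN g = 1 -> 1 + d - eps <= dN (f + t *: g).
Proof.
move=> eps0; rewrite /delta_star leeBrDr// => dle f1.
have : ((1 + d - eps)%:E < ereal_sup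
       [set ereal_inf [set (dual_norm N (f + t *: g)%R)%:E |
                        g in unit_sphere N E]
       | E in @cofin_star _ X])%E.
  apply: (@lt_le_trans _ _ (d%:E + 1)%E).
    by rewrite -EFinD lte_fin; lra.
  apply: (le_trans dle); apply: ereal_inf_lbound.
  by exists f => //; split.
move=> /ereal_sup_gt[_ [E Ecof <-]] lt_inf.
exists E => // g Eg g1; rewrite -lee_fin (le_trans (ltW lt_inf))//.
by apply: ereal_inf_lbound; exists g.
Qed.

Let dual_norm_cvg0 (z : nat -> dual X) :
  `|z n| @[n --> U] --> (0 : R) -> dN (z n) @[n --> U] --> (0 : R).
Proof.
have [b [B [b0 B0 bB]]] := dual_norm_equivalent hN.
move=> z0; apply: (@squeeze_cvgr _ _ _ _ (cst 0) (fun n => B * `|z n|)).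
- by apply: nearW => n; rewrite dual_norm_ge0//=; have [] := bB (z n).
- exact: cvg_cst.
- by rewrite -[X in _ --> X](mulr0 B); apply: cvgMr.
Qed.

(** The modulus tests perturbations by unit vectors of a subspace [E]; here
they are replaced by a weak-star null family whose norms tend to [tau], using
elements [e n] of [E] close to [z n]. Their norms tend to [tau > 0], so they are
eventually nonzero and can be normalized. *)
Lemma asymptotic_convexity_scaled (t d tau eps : R) (z : nat -> dual X) f :
  0 < eps -> 0 <= t -> (d%:E <= delta_star N t)%E -> dN f = 1 ->
  (forall x, z n x @[n --> U] --> (0 : R)) ->
  0 < tau -> dN (z n) @[n --> U] --> tau ->
  \forall n \near U, 1 + d - eps <= dN (f + (t / tau) *: z n).
Proof.
move=> eps0 t0 dle f1 z0 tau0 ztau.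
have eps2 : 0 < eps / 2 by rewrite divr_gt0.
have [E Ecof EP] := delta_star_witness eps2 dle f1.
have [e Ee ze] := cofin_star_approx Ecof z0.
have [_ Elin] : linear_subspace E by case: Ecof.
have E0 : E 0 by case: Ecof => -[].
have {}ze := dual_norm_cvg0 ze.
have etau : dN (e n) @[n --> U] --> tau.
  apply/cvgrPdist_le => r r0; near=> n.
  rewrite (_ : tau - _ = (tau - dN (z n)) + (dN (z n) - dN (e n))); last by ring.
  rewrite (le_trans (ler_normD _ _))// [r]splitr lerD//.
    near: n; apply: (proj1 (cvgrPdist_le _ _) ztau); exact: divr_gt0.
  rewrite (le_trans (dual_normB_dist hN _ _))//.
  rewrite -[leLHS]ger0_norm ?dual_norm_ge0//.
  near: n; apply: (proj1 (cvgr0Pnorm_le _) ze); exact: divr_gt0.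
pose u n := t * (dN (z n - e n) / tau + `|dN (e n) / tau - 1|).
have u0 : u n @[n --> U] --> (0 : R).
  rewrite -[X in _ --> X](mulr0 t); apply: cvgMr.
  rewrite -[X in _ --> X]addr0; apply: cvgD.
    by rewrite -[X in _ --> X](mul0r tau^-1); apply: cvgMl.
  rewrite -[X in _ --> X](@normr0 R R); apply: cvg_norm.
  rewrite -(subrr 1); apply: cvgB; last exact: cvg_cst.
  by rewrite -[X in _ --> X](@divff _ tau) ?gt_eqF//; apply: cvgMl.
near=> n.
have e0 : 0 < dN (e n).
  near: n; exact: (cvgr_gt tau etau).
have un : u n <= eps / 2.
  rewrite (le_trans (ler_norm _))//; near: n.
  exact: (proj1 (cvgr0Pnorm_le _) u0).
have := EP ((dN (e n))^-1 *: e n).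
rewrite dual_normZ// normfV gtr0_norm// mulVf ?gt_eqF//.
rewrite -[_ *: e n]addr0 => /(_ (Elin _ _ _ (Ee n) E0) erefl).
rewrite addr0 => fe.
have : dN (t *: ((dN (e n))^-1 *: e n - tau^-1 *: z n)) <= u n.
  rewrite dual_normZ// (ger0_norm t0) ler_wpM2l//.
  rewrite (_ : _ - _ = tau^-1 *: (e n - z n) + ((dN (e n))^-1 - tau^-1) *: e n).
    rewrite (le_trans (dual_normD hN _ _))// !dual_normZ// lerD//.
      rewrite -(dual_normN hN (z n - _)) opprB mulrC.
      by rewrite gtr0_norm// invr_gt0.
    rewrite -[X in _ * X](gtr0_norm e0) -normrM mulrBl mulVf ?gt_eqF//.
    by rewrite distrC mulrC.
  by rewrite scalerBr scalerBl [RHS]addrC [RHS]addrA subrK.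
have := dual_normD hN (f + (t / tau) *: z n)
  (t *: ((dN (e n))^-1 *: e n - tau^-1 *: z n)).
rewrite -addrA [(t / tau) *: _ + _](_ : _ = t *: ((dN (e n))^-1 *: e n)); last first.
  by rewrite -scalerA -scalerDr addrC subrK.
by lra.
Unshelve. all: by end_near. Qed.

(** Let [r], [tau] and [sg] be the norm of [f] and the limits of the norms of
[z n] and [f + z n]. If [tau <= r], convexity at scale [tau / r] gives
[sg >= r * (1 + C * (tau / r) `^ q)]. The modulus is only controlled on [0, 1],
so if [r < tau] it is used at scale 1: convexity of the norm along the segment
from [f] to [f + z n] then gives [sg >= r + C * tau]. The three terms in the
minimum serve the cases [r = 0], [tau <= r] and [r < tau]. *)
Lemma asymptotic_lower_estimate (C q B eps : R) (z : nat -> dual X) f :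
  0 < C -> 1 <= q ->
  (forall t, 0 <= t <= 1 -> ((C * t `^ q)%:E <= delta_star N t)%E) ->
  0 < eps -> (forall x, z n x @[n --> U] --> (0 : R)) ->
  (forall n, dN (z n) <= B) ->
  \forall n \near U,
    dN f `^ q + Num.min 1 (Num.min C (C `^ q)) * dN (z n) `^ q - eps
      <= dN (f + z n) `^ q.
Proof.
move=> C0 q1 Cle eps0 z0 zB; set c := Num.min 1 _.
have q0 : 0 < q by rewrite (lt_le_trans _ q1).
have powR_le a b : 0 <= a -> a <= b -> a `^ q <= b `^ q.
  move=> a0 ab; apply: ge0_ler_powR => //; first exact: ltW.
  by rewrite nnegrE (le_trans a0).
have Cq0 : 0 < C `^ q by rewrite powR_gt0.
have c0 : 0 < c by rewrite !lt_min C0 Cq0 ltr01.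
have [c1 [cC cCq]] : c <= 1 /\ c <= C /\ c <= C `^ q.
  by rewrite /c !ge_min !lexx !orbT.
set r := dN f; have r0 : 0 <= r by exact: dual_norm_ge0.
have [tau ztau] : exists tau : R, dN (z n) @[n --> U] --> tau.
  apply: (@ultra_bounded_cvg _ _ _ _ _ B); apply: nearW => n.
  by rewrite ger0_norm ?dual_norm_ge0.
have [sg zsg] : exists sg : R, dN (f + z n) @[n --> U] --> sg.
  apply: (@ultra_bounded_cvg _ _ _ _ _ (r + B)); apply: nearW => n.
  rewrite ger0_norm ?dual_norm_ge0// (le_trans (dual_normD hN _ _))//.
  by rewrite lerD2l.
have tau0 : 0 <= tau.
  by apply: (cvgr_to_ge ztau); apply: nearW => n; exact: dual_norm_ge0.
have sg0 : 0 <= sg.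
  by apply: (cvgr_to_ge zsg); apply: nearW => n; exact: dual_norm_ge0.
suff main : r `^ q + c * tau `^ q <= sg `^ q.
  have lim : (dN (f + z n) `^ q - c * dN (z n) `^ q) @[n --> U] -->
      sg `^ q - c * tau `^ q.
    apply: cvgB; last apply: cvgMr.
      by apply: powR_cvg => // n; exact: dual_norm_ge0.
    by apply: powR_cvg => // n; exact: dual_norm_ge0.
  have : r `^ q - eps < sg `^ q - c * tau `^ q by lra.
  by move=> /(cvgr_gt _ lim); apply: filterS => n; lra.
have [tau_eq0|taun0] := eqVneq tau 0.
  rewrite tau_eq0 powR0 ?gt_eqF// mulr0 addr0; apply: powR_le => //.
  rewrite -[leRHS]addr0 -tau_eq0.
  apply: (cvgr_to_ge (cvgD zsg ztau)); apply: nearW => n.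
  have := dual_normD hN (f + z n) (- z n).
  by rewrite addrK (dual_normN hN).
have {taun0} tau_gt0 : 0 < tau by rewrite lt_def taun0.
have [r_eq0|rn0] := eqVneq r 0.
  rewrite r_eq0 powR0 ?gt_eqF// add0r.
  apply: (@le_trans _ _ (tau `^ q)); first by rewrite ler_piMl// powR_ge0.
  apply: powR_le => //.
  rewrite -[leRHS]addr0 -r_eq0.
  apply: (ler_cvg_to ztau (cvgD zsg (cvg_cst r))); apply: nearW => n.
  have := dual_normD hN (f + z n) (- f).
  by rewrite {1}(addrC f) addrK (dual_normN hN).
have {rn0} r_gt0 : 0 < r by rewrite lt_def rn0.
have f1 : dN (r^-1 *: f) = 1.
  by rewrite dual_normZ// gtr0_norm ?invr_gt0// mulVf ?gt_eqF.
have [tau_le|r_lt] := leP tau r.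
  have t01 : 0 <= tau / r <= 1 by rewrite divr_ge0//= ler_pdivrMr// mul1r.
  have t0 : 0 <= tau / r by case/andP: t01.
  have Ct0 : 0 <= C * (tau / r) `^ q by rewrite mulr_ge0 ?powR_ge0// ltW.
  have sgE : 1 + C * (tau / r) `^ q <= sg / r.
    apply/ler_addgt0Pr => d d0; rewrite -lerBlDr.
    have zr : dN (f + z n) / r @[n --> U] --> sg / r by exact: cvgMl.
    apply: (cvgr_to_ge zr).
    have := asymptotic_convexity_scaled d0 t0 (Cle _ t01) f1 z0 tau_gt0 ztau.
    apply: filterS => n /le_trans; apply.
    rewrite mulrAC divff ?gt_eqF// mul1r -scalerDr dual_normZ//.
    by rewrite gtr0_norm ?invr_gt0// mulrC.
  have sgE' : r * (1 + C * (tau / r) `^ q) <= sg.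
    by rewrite mulrC -ler_pdivlMr.
  apply: (@le_trans _ _ ((r * (1 + C * (tau / r) `^ q)) `^ q)); last first.
    by apply: powR_le => //; rewrite mulr_ge0// addr_ge0.
  rewrite powRM ?addr_ge0//.
  apply: (@le_trans _ _ (r `^ q * (1 + C * (tau / r) `^ q))); last first.
    by rewrite ler_wpM2l ?powR_ge0// le1r_powR// lerDl.
  rewrite mulrDr mulr1 lerD2l mulrCA -powRM// mulrCA divff ?gt_eqF// mulr1.
  by rewrite ler_wpM2r ?powR_ge0.
(* Here r < tau, and r^-1 f + tau^-1 z is the sum of (r^-1 - tau^-1) f and
   tau^-1 (f + z). *)
have r_ge : r + C * tau <= sg.
  have : 1 + C <= 1 - r / tau + sg / tau.
    apply/ler_addgt0Pr => d d0; rewrite -lerBlDr.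
    have zr : 1 - r / tau + dN (f + z n) / tau @[n --> U] --> 1 - r / tau + sg / tau.
      by apply: cvgD; [exact: cvg_cst|exact: cvgMl].
    apply: (cvgr_to_ge zr).
    have C1 : ((C * 1 `^ q)%:E <= delta_star N 1)%E by apply: Cle; rewrite ler01/=.
    have := asymptotic_convexity_scaled d0 ler01 C1 f1 z0 tau_gt0 ztau.
    rewrite powR1 mulr1; apply: filterS => n /le_trans; apply.
    rewrite div1r (_ : _ + _ = (r^-1 - tau^-1) *: f + tau^-1 *: (f + z n)); last first.
      by rewrite scalerBl scalerDr addrA subrK.
    rewrite (le_trans (dual_normD hN _ _))// !dual_normZ// lerD//.
      rewrite ger0_norm; last by rewrite subr_ge0 lef_pV2 ?posrE// ltW.
      by rewrite -/r mulrBl mulVf ?gt_eqF// mulrC.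
    by rewrite gtr0_norm ?invr_gt0// mulrC.
  rewrite -addrA lerD2l addrC -mulrBl ler_pdivlMr//; lra.
apply: (@le_trans _ _ ((r + C * tau) `^ q)); last first.
  by apply: powR_le => //; rewrite addr_ge0// mulr_ge0// ltW.
apply: le_trans (powR_superadd q1 r0 _); last by rewrite mulr_ge0 ?ltW.
rewrite lerD2l powRM//; last exact: ltW.
by rewrite ler_wpM2r ?powR_ge0.
Qed.

End asymptotic_convexity.

(** The estimate |f + z|^q >= |f|^q + c |z|^q for weak-star null perturbations
[z]; the error [eps] avoids naming the limits of the norms. *)
Definition lower_estimate {R : realType} (X : normedModType R) (N : X -> R)
    (q c : R) : Prop :=
  forall U : set_system nat, UltraFilter U ->
  forall (B eps : R) (z : nat -> dual X) (f : dual X),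
    0 < eps -> (forall x, z n x @[n --> U] --> (0 : R)) ->
    (forall n, dual_norm N (z n) <= B) ->
    \forall n \near U, dual_norm N f `^ q + c * dual_norm N (z n) `^ q - eps
      <= dual_norm N (f + z n) `^ q.

Lemma AUC_star_lower_estimate (R : realType) (X : normedModType R) (N : X -> R)
    (q : R) : equivalent_norm N -> 1 <= q -> AUC_star q N ->
  exists2 c, 0 < c & lower_estimate N q c.
Proof.
move=> hN q1 [C C0 Cle]; exists (Num.min 1 (Num.min C (C `^ q))).
  by rewrite !lt_min C0 ltr01 powR_gt0.
move=> U UF B eps z f eps0 z0 zB.
exact: (asymptotic_lower_estimate hN f C0 q1 Cle eps0 z0 zB).
Qed.

(** * Iterated weak-star limits *)

Section weak_star_trees.
Context {R : realType} (X : normedModType R).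
Context (T : Type) (U : set_system T) {UF : UltraFilter U}.

(** The Banach-Alaoglu theorem in the form needed here: the limit is taken
pointwise, and inherits linearity and the norm bound. *)
Lemma weak_star_lim (z : T -> dual X) (B : R) : (forall n, `|z n| <= B) ->
  exists v : dual X, `|v| <= B /\ forall x, z n x @[n --> U] --> (v x : R).
Proof.
move=> zB.
have zxB n x : `|z n x| <= B * `|x|.
  by rewrite (le_trans (dual_norm_bound _ _))// -dual_normE ler_wpM2r.
have /choice[g gE] : forall x, exists l : R, z n x @[n --> U] --> l.
  move=> x; apply: (@ultra_bounded_cvg _ _ _ _ _ (B * `|x|)).
  by apply: nearW => n; exact: zxB.
have gB x : `|g x| <= B * `|x|.
  by apply: (cvgr_to_le (cvg_norm (gE x))); apply: nearW => n; exact: zxB.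
have glin : linear (g : X -> R^o).
  move=> a x y; apply: (cvg_unique _ (gE _)) => //.
  rewrite (_ : (fun n => _) = fun n => a * z n x + z n y).
    2: by apply/funext => n; rewrite dual_linear.
  by apply: cvgD; [apply: cvgMr|]; exact: gE.
pose gl : {linear X -> R^o} := HB.pack (g : X -> R^o)
  (GRing.isLinear.Build R X R^o _ (g : X -> R^o) glin).
have gcont : continuous (g : X -> R^o).
  apply: (@bounded_linear_continuous R X R^o gl); apply/bounded_funP => r.
  exists (`|B| * `|r|) => x xr /=; rewrite (le_trans (gB x))//.
  rewrite (@le_trans _ _ (`|B| * `|x|))// ?ler_wpM2r// ?ler_norm//.
  by rewrite ler_wpM2l// (le_trans xr)// ler_norm.
have gdual : (g : X -> R^o) \in @dual_pred _ X by rewrite inE; split.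
exists (Dual gdual); split; last exact: gE.
rewrite dual_normE; apply: ge_sup; first by exists `|Dual gdual 0|, 0; rewrite //= normr0.
have [t0 _] := filter_ex (@filterT _ U _).
have B0 : 0 <= B by exact: le_trans (zB t0).
by move=> _ [x /= x1 <-]; rewrite (le_trans (gB x))// ler_piMr.
Qed.

(** Induction on the depth: weak-star limits in the last coordinate turn the
values [h] at level [k.+1] into values [h1] at level [k]. *)
Lemma weak_star_tree k (h : seq T -> dual X) (B : R) : (forall s, `|h s| <= B) ->
  exists g : seq T -> dual X, [/\ forall s, size s = k -> g s = h s,
    forall s, `|g s| <= B &
    forall s x, (size s < k)%N -> g (rcons s n) x @[n --> U] --> (g s x : R)].
Proof.
elim: k h => [|k IH] h hB; first by exists h; split.
have /choice[h1 h1P] : forall s, exists v : dual X, `|v| <= B /\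
    forall x, h (rcons s n) x @[n --> U] --> (v x : R).
  by move=> s; exact: weak_star_lim.
have [g1 [g1E g1B g1l]] := IH h1 (fun s => (h1P s).1).
exists (fun s => if size s == k.+1 then h s else g1 s); split.
- by move=> s ->; rewrite eqxx.
- by move=> s; case: ifP.
- move=> s x; rewrite ltnS => sk.
  rewrite (ltn_eqF (sk : (size s < k.+1)%N)); under eq_fun do rewrite size_rcons eqSS.
  have [/g1E ->|skn] := eqVneq (size s) k; first exact: (h1P s).2.
  by apply: g1l; rewrite ltn_neqAle skn.
Qed.

End weak_star_trees.

(** * Trees with many successors *)

Lemma path_ltn_last x s : path ltn x s ->
  all (fun i => i <= last x s)%N (x :: s).
Proof.
elim: s x => [|y s IH] x /=; first by rewrite leqnn.
move=> /andP[xy /IH/= /andP[yl ->]]; rewrite yl !andbT.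
by rewrite (leq_trans (ltnW xy)).
Qed.

Section tree_extraction.
Context (U : set_system nat) {UF : ProperFilter U}.

(** There are finitely many sequences of bounded length with bounded entries;
the induction on the length only uses finite intersections over the first
entry. *)
Lemma filter_bounded_seqs (G : seq nat -> set nat) (n k : nat) :
  (forall s, U (G s)) ->
  \forall a \near U, forall s, (size s <= k)%N -> all (fun i => i <= n)%N s -> G s a.
Proof.
elim: k G => [|k IH] G UG.
  by apply: filterS (UG [::]) => a Ga [|//].
have : \forall a \near U, forall i : 'I_n.+1, forall s, (size s <= k)%N ->
    all (fun i => i <= n)%N s -> G (val i :: s) a.
  by apply: filter_forall => i; exact: (IH (fun s => G (val i :: s))).
move=> UI; apply: filterS2 (UG [::]) UI => a G0 GI [//|i s] /= sk /andP[ni sn].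
exact: (GI (Ordinal (ni : (i < n.+1)%N))).
Qed.

(** A diagonal argument. For every [n], the set of the [a > n] such that
[rcons s a] is in the tree for every node [s] with entries at most [n] belongs
to [U] (lengths being at most [k]); let [next n] be one of its elements. The set
[M] consists of [next 0], [next (next 0)], and so on. If [a = next b] is one of
them, then [a] is admissible after every increasing sequence in [M] with entries
below [a], as these entries are at most [b]. *)
Lemma tree_extraction (P : seq nat -> Prop) (k : nat) : \oo `<=` U ->
  P [::] ->
  (forall s, (size s < k)%N -> P s -> \forall a \near U, P (rcons s a)) ->
  exists M : set nat, [/\ M `<=` [set i | (0 < i)%N], infinite_set M &
    forall s, (size s <= k)%N -> path ltn 0%N s -> (forall i, i \in s -> M i) -> P s].
Proof.
move=> ooU P0 PS.
pose G s := [set a | (size s < k)%N -> P s -> P (rcons s a)].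
have UG s : U (G s).
  have [[sk Ps]|nsk] := pselect ((size s < k)%N /\ P s).
    by apply: filterS (PS s sk Ps) => a Pa _ _.
  by apply: (@filterS _ _ _ setT) => [a _ sk Ps|]; [case: nsk|exact: filterT].
have /choice[next nextP] : forall n, exists a, (n < a)%N /\
    forall s, (size s <= k)%N -> all (fun i => i <= n)%N s -> G s a.
  move=> n; apply: (@filter_ex _ U); apply: filterI.
    by apply: ooU; exists n.+1.
  exact: filter_bounded_seqs.
pose m i := iter i next 0%N.
have mS i : (m i < m i.+1)%N by have [] := nextP (m i).
have m_lt : {homo m : i j / (i < j)%N}.
  by apply: homo_ltn => //; exact: ltn_trans.
have m_mono : {mono m : i j / (i <= j)%N} by exact: leq_mono.
exists [set m i.+1 | i in setT]; split.
- by move=> _ [i _ <-] /=; rewrite (leq_trans _ (mS i)).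
- have minj i j : m i.+1 = m j.+1 -> i = j.
    move=> mij; case: (ltngtP i j) => // ij.
      by have := m_lt i.+1 j.+1 ij; rewrite mij ltnn.
    by have := m_lt j.+1 i.+1 ij; rewrite mij ltnn.
  have minj' : set_inj setT (fun i => m i.+1) by move=> i j _ _; exact: minj.
  by rewrite (eq_finite_set (inj_card_eq minj')); exact: infinite_nat.
- move=> s; elim/last_ind: s => [//|s a IH].
  rewrite size_rcons rcons_path => sk /andP[s_path sa] sM.
  have [i _ ia] : [set m i.+1 | i in setT] a by apply: sM; rewrite mem_rcons mem_head.
  rewrite -ia in sa *.
  have sM' j : j \in s -> [set m i.+1 | i in setT] j.
    by move=> js; apply: sM; rewrite mem_rcons in_cons js orbT.
  have [_ /(_ s (ltnW sk))] := nextP (m i); apply => //; last first.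
    exact: IH (ltnW sk) s_path sM'.
  apply/allP => j js; have [l _ lj] := sM' j js; rewrite -lj.
  have : (j <= last 0%N s)%N.
    by move/allP: (path_ltn_last s_path); apply; rewrite in_cons js orbT.
  move=> /leq_ltn_trans/(_ sa); rewrite -lj => li.
  rewrite (m_mono l.+1 i) ltnNge; apply: contraTN li => il.
  by rewrite -leqNgt (m_mono i.+1 l.+1).
Qed.

End tree_extraction.

(** * Interlacing sequences *)

Section interlacing.

(** The interlacing relation of the graph on untyped sequences of any length,
which can be built one coordinate at a time. *)
Definition interlacing (n m : seq nat) : Prop :=
  [/\ size m = size n, path ltn 0%N n, path ltn 0%N m,
      forall i, (i < size n)%N -> (nth 0 n i <= nth 0 m i)%N &
      forall i, (i.+1 < size n)%N -> (nth 0 m i <= nth 0 n i.+1)%N].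

Lemma interlacing_rcons n m a b : interlacing n m ->
  (last 0 n < a)%N -> (last 0 m < a)%N -> (a <= b)%N ->
  interlacing (rcons n a) (rcons m b).
Proof.
move=> [mn n_path m_path nm mn1] na ma ab; split.
- by rewrite !size_rcons mn.
- by rewrite rcons_path n_path.
- by rewrite rcons_path m_path /= (leq_trans ma).
- move=> i; rewrite size_rcons ltnS !nth_rcons mn leq_eqVlt.
  by case/predU1P => [->|ilt]; rewrite ?ltnn ?eqxx// ilt nm.
- move=> i; rewrite size_rcons ltnS !nth_rcons mn => ilt; rewrite ilt.
  move: ilt; rewrite leq_eqVlt => /predU1P[iE|ilt]; last by rewrite ilt mn1.
  rewrite iE ltnn eqxx (leq_trans _ (ltnW ma))//.
  by rewrite -nth_last mn -iE.
Qed.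

(** Two consecutive windows of an increasing sequence interlace: sliding the
window moves [n] to any tuple located after it in [size n] steps. *)
Lemma interlacing_windows k j (s : seq nat) : path ltn 0%N s -> (k + j < size s)%N ->
  interlacing (take k (drop j s)) (take k (drop j.+1 s)).
Proof.
move=> s_path kj.
have win_path i : path ltn 0%N (take k (drop i s)).
  apply: (subseq_path ltn_trans _ s_path).
  by apply: subseq_trans (drop_subseq s i); exact: take_subseq.
have win_size i : (i <= j.+1)%N -> size (take k (drop i s)) = k.
  by move=> ij; rewrite size_takel// size_drop; lia.
have s_lt a b : (a <= b)%N -> (b < size s)%N -> (nth 0 s a <= nth 0 s b)%N.
  rewrite leq_eqVlt => /predU1P[->//|ab] bs; apply: ltnW.
  by apply: (sorted_ltn_nth ltn_trans 0 (path_sorted s_path)) => //;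
    rewrite inE// (ltn_trans ab).
split => // [|i|i]; rewrite !win_size// => ik.
  by rewrite !nth_take// !nth_drop s_lt//; lia.
by rewrite !nth_take ?nth_drop ?s_lt//; lia.
Qed.

(** The diameter of the graph is at most [k + k]: both tuples are joined to a
third one located after both of them. *)
Lemma interlacing_chain (R : numDomainType) (Z : normedZmodType R) k
    (F : seq nat -> Z) (w : R) :
  (forall n m, size n = k -> interlacing n m -> `|F n - F m| <= w) ->
  forall n m, size n = k -> size m = k -> path ltn 0%N n -> path ltn 0%N m ->
  `|F n - F m| <= w *+ (k + k).
Proof.
move=> Fw.
have shift n m : size n = k -> size m = k -> path ltn 0%N (n ++ m) ->
    `|F n - F m| <= w *+ k.
  move=> nk mk nm_path.
  have step j : (j <= k)%N ->
      `|F (take k (drop 0 (n ++ m))) - F (take k (drop j (n ++ m)))| <= w *+ j.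
    elim: j => [|j IH] jk; first by rewrite subrr normr0 mulr0n.
    rewrite -(subrKA (F (take k (drop j (n ++ m))))) mulrSr.
    rewrite (le_trans (ler_normD _ _))// lerD ?IH 1?ltnW//.
    apply: Fw; last by apply: interlacing_windows; rewrite // size_cat nk mk; lia.
    by rewrite size_takel// size_drop size_cat nk mk; lia.
  have := step k (leqnn k).
  by rewrite drop0 -{1}nk take_size_cat// drop_size_cat// -{1}mk take_size.
move=> n m nk mk n_path m_path.
pose a := (last 0 n + last 0 m)%N.
have cat_iota s : (last 0 s <= a)%N -> path ltn 0%N s ->
    path ltn 0%N (s ++ iota a.+1 k).
  move=> sa s_path; rewrite cat_path s_path path_sortedE; last exact: ltn_trans.
  rewrite iota_ltn_sorted andbT; apply/allP => i; rewrite mem_iota => /andP[ai _].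
  exact: leq_ltn_trans sa ai.
rewrite -(subrKA (F (iota a.+1 k))) mulrnDr (le_trans (ler_normD _ _))// lerD//.
  by apply: shift; rewrite ?size_iota// cat_iota// leq_addr.
by rewrite distrC; apply: shift; rewrite ?size_iota// cat_iota// leq_addl.
Qed.

End interlacing.

(** * Maps on the interlaced graph *)

Section ksubsets.
Context {R : realType} (k : nat) (Z : normedModType R) (f : ksubset k -> Z).

(** The value 0 outside the set of tuples keeps the extension bounded. *)
Definition ksubset_extension (s : seq nat) : Z :=
  oapp f 0 (obind insub (insub s : option (k.-tuple nat))).

Lemma ksubset_extensionE (n : ksubset k) :
  ksubset_extension (val (val n)) = f n.
Proof. by rewrite /ksubset_extension valK/= valK. Qed.

Lemma ksubset_seqP (s : seq nat) : size s = k -> path ltn 0%N s ->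
  exists n : ksubset k, val (val n) = s.
Proof.
move=> /eqP sk s_path.
by exists (Sub (Tuple sk) (s_path : path ltn 0%N (Tuple sk))).
Qed.

Lemma ksubset_inhabited : inhabited (ksubset k).
Proof.
have [||n _] := @ksubset_seqP (iota 1 k); [by rewrite size_iota| |by exists].
rewrite path_sortedE; last exact: ltn_trans.
rewrite iota_ltn_sorted andbT; apply/allP => i.
by rewrite mem_iota => /andP[].
Qed.

Lemma ksubset_extension_bounded (B : R) : 0 <= B -> (forall n, `|f n| <= B) ->
  forall s, `|ksubset_extension s| <= B.
Proof.
move=> B0 fB s; rewrite /ksubset_extension.
by case: obind => [n|]/=; rewrite ?normr0.
Qed.

Lemma interlaced_dist_le1 (n m : ksubset k) : (n == m) || interlaced n m ->
  (interlaced_dist n m <= 1)%N.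
Proof.
move=> nm; rewrite /interlaced_dist; case: ex_minnP => d _ d_min.
move: nm; have [nm_eq _|nm_neq /= nm] := eqVneq n m.
  apply: leq_trans (d_min 0%N _) _ => //; apply/asboolP.
  by exists [::]; split.
apply: d_min; apply/asboolP; exists [:: m]; split => //=.
by rewrite andbT /interlaced_adj/= nm_neq nm.
Qed.

Lemma lipschitz_modulus : is_lipschitz (@dK R k) f -> exists w : R,
  [/\ 0 <= w, modulus (@dK R k) f 1 = w%:E &
    forall n m, interlaced n m -> `|f n - f m| <= w].
Proof.
move=> [L fL].
have [n0] := ksubset_inhabited.
have mod_ge n m : (n == m) || interlaced n m ->
    (`|f n - f m|%:E <= modulus (@dK R k) f 1)%E.
  move=> nm; apply: ereal_sup_ubound; exists (n, m) => //=.
  by rewrite /dK lern1 interlaced_dist_le1.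
have mod_ge0 : (0 <= modulus (@dK R k) f 1)%E.
  by apply: le_trans (mod_ge n0 n0 _); rewrite ?lee_fin// eqxx.
have mod_le : (modulus (@dK R k) f 1 <= `|L|%:E)%E.
  apply: ge_ereal_sup => _ [[n m]/= nm <-]; rewrite lee_fin.
  apply: (le_trans (fL n m)); rewrite (le_trans (ler_norm _))// normrM.
  by rewrite ler_piMr// ger0_norm// /dK ler0n.
have mod_fin : modulus (@dK R k) f 1 \is a fin_num.
  by rewrite fin_numE -ltNye -ltey (lt_le_trans _ mod_ge0)//=
    (le_lt_trans mod_le)//= ltry.
exists (fine (modulus (@dK R k) f 1)); split.
- exact: fine_ge0.
- by rewrite fineK.
- move=> n m nm; rewrite -lee_fin fineK//; apply: mod_ge.
  by rewrite nm orbT.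
Qed.

End ksubsets.

Lemma interlacing_interlaced k (n m : ksubset k) :
  interlacing (val (val n)) (val (val m)) -> interlaced n m.
Proof.
move=> [_ _ _ nm mn]; apply/andP; split; apply/forallP => i.
  by apply: nm; rewrite size_tuple.
by apply/implyP => ik; apply: mn; rewrite size_tuple.
Qed.

(** * Variation along the branches of a tree *)

Section alternating_trees.
Context {R : realType} (X : normedModType R) (N : X -> R).
Hypothesis hN : equivalent_norm N.
Local Notation dN := (dual_norm N).
Context (g : seq nat -> dual X) (q : R).

Definition increment (n : seq nat) (i : nat) : R :=
  dN (g (take i.+1 n) - g (take i n)).

Definition variation (n : seq nat) : R := \sum_(i < size n) increment n i `^ q.

Let increment_rcons n a i : (i < size n)%N ->
  increment (rcons n a) i = increment n i.
Proof. by move=> ilt; rewrite /increment -cats1 !takel_cat// ltnW. Qed.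

Let increment_rcons_last n a :
  increment (rcons n a) (size n) = dN (g (rcons n a) - g n).
Proof.
congr (dN (g _ - g _)); first by rewrite take_oversize// size_rcons.
by rewrite -cats1 take_size_cat.
Qed.

Lemma variation_rcons n a :
  variation (rcons n a) = variation n + dN (g (rcons n a) - g n) `^ q.
Proof.
rewrite /variation size_rcons big_ord_recr/= increment_rcons_last.
by congr (_ + _); apply: eq_bigr => i _; rewrite increment_rcons.
Qed.

Lemma dual_norm_le_increments n :
  dN (g n - g [::]) <= \sum_(i < size n) increment n i.
Proof.
elim/last_ind: n => [|n a IH]; first by rewrite subrr dual_norm0// big_ord0.
rewrite size_rcons big_ord_recr/= increment_rcons_last -(subrKA (g n)).
rewrite (le_trans (dual_normD hN _ _))//.
rewrite [leRHS]addrC lerD2l (le_trans IH)// ler_sum// => i _.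
by rewrite increment_rcons.
Qed.

Context (U : set_system nat) {UF : UltraFilter U}.
Hypothesis ooU : \oo `<=` U.

(** The property of [n] carried through the construction of the tree: [n] has
an interlacing partner whose image is far from that of [n], in terms of the
variation along [n]. Each coordinate costs two applications of the lower
estimate, hence an error [2 * eps]. *)
Definition has_far_partner (c eps : R) (n : seq nat) : Prop :=
  exists2 m, interlacing n m &
    c * variation n - 2 * eps * (size n)%:R <= dN (g n - g m) `^ q.

(** The vector [g n - g m] is perturbed first by [g (rcons n a) - g n], where
[a] tends to [U], then by [g m - g (rcons m b)], where [b] tends to [U] with [a]
fixed. The first perturbation contributes the new term of the variation. Only
one value of [b] is kept, since the conclusion concerns [n]. *)
Lemma has_far_partner_rcons (k : nat) (c B eps : R) (n : seq nat) :
  lower_estimate N q c -> 0 <= c -> 0 < eps ->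
  (forall s, `|g s| <= B) ->
  (forall s x, (size s < k)%N -> g (rcons s a) x @[a --> U] --> (g s x : R)) ->
  (size n < k)%N -> has_far_partner c eps n ->
  \forall a \near U, has_far_partner c eps (rcons n a).
Proof.
move=> Nc c0 eps0 gB gl nk [m nm nm_var].
have [b0 [B1 [_ B10 NB]]] := dual_norm_equivalent hN.
have gdB s t : dN (g s - g t) <= B1 * (B + B).
  apply: (le_trans (NB _).1); apply: ler_wpM2l; first exact: ltW.
  by rewrite (le_trans (ler_normB _ _))// lerD.
have gt_near x : \forall a \near U, (x < a)%N by apply: ooU; exists x.+1.
have lim0 s x : (size s < k)%N -> (g (rcons s a) - g s) x @[a --> U] --> (0 : R).
  move=> sk; rewrite -(subrr (g s x)); apply: cvgB; first exact: gl.
  exact: cvg_cst.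
have est1 := Nc U UF _ eps (fun a => g (rcons n a) - g n) (g n - g m) eps0
  (fun x => lim0 n x nk) (fun a => gdB _ _).
apply: filterS3 (gt_near (last 0%N n)) (gt_near (last 0%N m)) est1 => a na ma.
rewrite [g n - g m + _]addrC subrKA => est1.
have mk : (size m < k)%N by case: nm => ->.
have [b [ab est2]] : exists b, (a <= b)%N /\
    dN (g (rcons n a) - g m) `^ q - eps <= dN (g (rcons n a) - g (rcons m b)) `^ q.
  have est2 := Nc U UF _ eps (fun b => g m - g (rcons m b))
    (g (rcons n a) - g m) eps0 _ (fun b => gdB _ _).
  apply: (@filter_ex _ U); apply: filterI.
    by apply: filterS (gt_near a) => b; exact: ltnW.
  apply: filterS (est2 _) => [b|x].
    rewrite subrKA; apply: le_trans.
    by rewrite lerD2r lerDl mulr_ge0 ?powR_ge0.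
  rewrite -oppr0; under eq_fun do rewrite -opprB.
  by apply: cvgN; exact: lim0.
exists (rcons m b); first exact: interlacing_rcons.
rewrite variation_rcons size_rcons -(natr1 (size n)) mulrDr mulrDr mulr1 opprD addrACA.
suff arith (P D e W Y Z : R) : W + D - e <= Y -> Y - e <= Z -> P <= W ->
  P + (D - 2 * e) <= Z by exact: arith est1 est2 nm_var.
by clear=> *; lra.
Qed.

End alternating_trees.

(** * Concentration *)

Section concentration.
Context {R : realType} (X : normedModType R) (N : X -> R).
Hypothesis hN : equivalent_norm N.
Local Notation dN := (dual_norm N).

(** The point [v] near which all values concentrate is the root of the tree of
iterated weak-star limits of [F]. *)
Lemma interlacing_concentration (q c w w' : R) (k : nat)
    (F : seq nat -> dual X) :
  lower_estimate N q c -> 0 < c -> 1 <= q -> (0 < k)%N -> 0 < w ->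
  (forall s, `|F s| <= w') ->
  (forall n m, size n = k -> interlacing n m -> dN (F n - F m) <= w) ->
  exists M : set nat, exists v : dual X,
    [/\ M `<=` [set i | (0 < i)%N], infinite_set M &
    forall n, size n = k -> path ltn 0%N n -> (forall i, i \in n -> M i) ->
      dN (F n - v) <= (1 + 2 / c) * w * k%:R `^ (1 - q^-1)].
Proof.
move=> Nc c0 q1 k0 w0 Fw' Fw.
have q0 : 0 < q by rewrite (lt_le_trans _ q1).
have [U [UF ooU]] := ultraFilterLemma (eventually_filter : ProperFilter \oo).
have [g [gF gB gl]] := @weak_star_tree R X nat U UF k F w' Fw'.
(* The k steps add up to an error 2 * eps * k = w `^ q. *)
pose eps : R := w `^ q / (2 * k%:R).
have kR0 : 0 < k%:R :> R by rewrite ltr0n.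
have eps0 : 0 < eps by rewrite divr_gt0 ?powR_gt0// mulr_gt0.
have root : has_far_partner N g q c eps [::].
  exists [::]; first by split.
  by rewrite /variation big_ord0 !mulr0 subrr powR_ge0.
have step n : (size n < k)%N -> has_far_partner N g q c eps n ->
    \forall a \near U, has_far_partner N g q c eps (rcons n a).
  by move=> nk; apply: (has_far_partner_rcons hN ooU Nc _ eps0 gB gl nk); exact: ltW.
have [M [M_pos M_inf M_far]] := tree_extraction ooU root step.
exists M, (g [::]); split => // n nk n_path nM.
have [|m nm n_var] := M_far n _ n_path nM; first by rewrite nk.
have mk : size m = k by case: nm => ->.
rewrite -gF//; apply: (le_trans (dual_norm_le_increments hN g n)).
rewrite nk; apply: sum_le_powR => // [|i|].
- by rewrite divr_ge0// ltW.
- exact: dual_norm_ge0.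
- have -> : \sum_(i < k) increment N g n i `^ q = variation N g q n.
    by rewrite /variation nk.
  rewrite mulrAC ler_pdivlMr// mulrC.
  have gw : dN (g n - g m) `^ q <= w `^ q.
    apply: ge0_ler_powR; rewrite ?nnegrE ?dual_norm_ge0//; try exact: ltW.
    by rewrite !gF//; exact: Fw.
  have epsE : 2 * eps * (size n)%:R = w `^ q.
    by rewrite nk /eps; field; rewrite gt_eqF.
  move: n_var; rewrite epsE lerBlDr => /le_trans; apply.
  by rewrite mulr_natl mulr2n lerD2r.
Qed.

End concentration.

Theorem theorem3p3 (R : realType) (X : completeNormedModType R)
  (p : \bar R) (q : R)
  (hp : (1 < p)%E) (hq : 1 <= q) (hpq : (p^-1 + (q%:E)^-1 = 1)%E)
  (hX : exists N : X -> R, equivalent_norm N /\ AUC_star q N) :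
  property_Q p (dual X).
Proof.
have [N [hN N_auc]] := hX.
have [c c0 Nc] := AUC_star_lower_estimate hN hq N_auc.
have q0 : 0 < q by rewrite (lt_le_trans _ hq).
have pE : fine p^-1 = 1 - q^-1.
  move: hpq; rewrite inver gt_eqF//; case: (p^-1)%E => [r| |] //= [<-].
  by rewrite addrK.
have [b [B [b0 B0 bB]]] := dual_norm_equivalent hN.
pose D := 1 + 2 / c.
have D0 : 0 < D by rewrite addr_gt0// divr_gt0.
exists (1 + b * (D * B + D * B)).
  by rewrite lerDl mulr_ge0 ?addr_ge0 ?mulr_ge0 ?ltW.
move=> k f k0 f_lip; rewrite pE.
have [w [w0 -> f_w]] := lipschitz_modulus f_lip.
pose F := ksubset_extension f.
have FE n : F (val (val n)) = f n by exact: ksubset_extensionE.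
have F_w n m : size n = k -> interlacing n m -> `|F n - F m| <= w.
  move=> nk nm; have [mn n_path m_path _ _] := nm.
  have [n' n'E] := ksubset_seqP nk n_path.
  have [m' m'E] := ksubset_seqP (etrans mn nk) m_path.
  by rewrite -n'E -m'E !FE f_w// interlacing_interlaced// n'E m'E.
have f_chain (n m : ksubset k) : `|f n - f m| <= w *+ (k + k).
  rewrite -!FE; apply: (interlacing_chain F_w); rewrite ?size_tuple//.
    exact: (valP n).
  exact: (valP m).
(* If w = 0, then f is constant, as the graph is connected. *)
have [w_eq0|wn0] := eqVneq w 0.
  exists [set i | (0 < i)%N]; split => //.
    apply: (@sub_infinite_set _ (range S)); first by move=> _ [i _ <-].
    rewrite (eq_finite_set (inj_card_eq _)); first exact: infinite_nat.
    by move=> i j _ _ [].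
  move=> n m _ _; rewrite w_eq0 mule0 mul0e lee_fin.
  by have := f_chain n m; rewrite w_eq0 mul0rn.
have {wn0} w_gt0 : 0 < w by rewrite lt_def wn0.
have [w' Fw'] : exists w', forall s, `|F s| <= w'.
  have [n0] := ksubset_inhabited k.
  exists (`|f n0| + w *+ (k + k)) => s.
  have B0' : 0 <= `|f n0| + w *+ (k + k) by rewrite addr_ge0// mulrn_wge0.
  apply: ksubset_extension_bounded => // n; rewrite -lerBlDl.
  by rewrite (le_trans (lerB_dist _ _)).
have FBw n m : size n = k -> interlacing n m -> dual_norm N (F n - F m) <= B * w.
  move=> nk nm; apply: (le_trans (bB _).1); apply: ler_wpM2l; first exact: ltW.
  exact: F_w.
have [M [v [M_pos M_inf Mv]]] := interlacing_concentration hN Nc c0 hq k0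
  (mulr_gt0 B0 w_gt0) Fw' FBw.
exists M; split => // n m nM mM.
have close n' : ksubsets_of M n' -> dual_norm N (f n' - v) <=
    D * (B * w) * k%:R `^ (1 - q^-1).
  move=> n'M; rewrite -FE; apply: Mv; rewrite ?size_tuple//.
  - exact: (valP n').
  - by move=> _ /(nthP 0%N)[i + <-]; rewrite size_tuple; exact: n'M.
rewrite -!EFinM lee_fin.
apply: (le_trans (bB _).2).
have : dual_norm N (f n - f m) <=
    D * (B * w) * k%:R `^ (1 - q^-1) + D * (B * w) * k%:R `^ (1 - q^-1).
  rewrite -(subrKA v) (le_trans (dual_normD hN _ _))// lerD// ?close//.
  by rewrite -(dual_normN hN) opprB close.
move=> /(ler_wpM2l (ltW b0))/le_trans; apply.
rewrite -mulrDl mulrA ler_wpM2r ?powR_ge0//.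
rewrite [leRHS]mulrDl mul1r [X in _ <= w + X](_ : _ = b * (D * (B * w) + D * (B * w))).
  by rewrite lerDr.
by ring.
Qed.
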